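(* Let $F$ be a field of arbitrary characteristic. (1) Let $\mathcal{B}$ be an associative unital $F$-algebra and let $V$ be a left $\mathcal{B}$-module such that $[\mathcal{B},\mathcal{B}]$ annihilates $V$; regard $V$ as a commutative $\mathcal{B}$-bimodule via $v\cdot b=b\cdot v$. Let $\langle\,,\rangle: V\times V\to\mathcal{B}$ be a $\mathcal{B}$-bilinear skew-symmetric mapping such that $\langle V,V\rangle\subseteq Z(\mathcal{B})$ and $$\langle u,v\rangle w+\langle v,w\rangle u+\langle w,u\rangle v=0\quad\text{for all }u,v,w\in V.$$ Let $\mathcal{A}=M_2(\mathcal{B})\oplus V^2$, where $V^2=\{(u,v)\mid u,v\in V\}\cong V\oplus V$, with the product defined, for $X=X_a+(x,y)$, $Y=Y_a+(z,t)$ with $X_a,Y_a\in M_2(\mathcal{B})$ and $(x,y),(z,t)\in V^2$, by $$XY=X_aY_a+\begin{pmatrix}-\langle x,t\rangle&-\langle y,t\rangle\\ \langle x,z\rangle&\langle y,z\rangle\end{pmatrix}+(z,t)X_a+(x,y)(Y_a)^*.$$ Then $\mathcal{A}$ is an alternative unital algebra containing $M_2(F)$ with the same unit. (2) Conversely, every unital alternative $F$-algebra that contains the matrix algebra $M_2(F)$ with the same unit is of this form, i.e. it is isomorphic to an algebra $M_2(\mathcal{B})\oplus V^2$ constructed as in (1) from some such $\mathcal{B}$, $V$ and $\langle\,,\rangle$.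
   Context: An algebra is alternative if $x^2y=x(xy)$ and $(xy)y=xy^2$ for all $x,y$. $[a,b]=ab-ba$, and $[\mathcal{B},\mathcal{B}]$ is the set (span) of commutators of $\mathcal{B}$. $Z(\mathcal{B})$ is the center of $\mathcal{B}$. Modules over unital algebras are unital. A mapping $\langle\,,\rangle$ is $\mathcal{B}$-bilinear if it is biadditive, $F$-bilinear, and $\langle bu,v\rangle=b\langle u,v\rangle=\langle u,bv\rangle$ for $b\in\mathcal{B}$. Skew-symmetric means $\langle v,v\rangle=0$ for all $v$ (hence $\langle u,v\rangle=-\langle v,u\rangle$). For $A=\begin{pmatrix}a&b\\c&d\end{pmatrix}\in M_2(\mathcal{B})$ and $(x,y)\in V^2$, $(x,y)A$ denotes the usual row-by-matrix product $(xa+yc,\;xb+yd)$, and $A^*=\begin{pmatrix}d&-b\\-c&a\end{pmatrix}$. *)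

(* Defs.v *)
From HB Require Import structures.
From mathcomp Require Import all_boot all_order all_algebra.
From mathcomp Require Import sesquilinear.

Set Implicit Arguments.
Unset Strict Implicit.
Unset Printing Implicit Defensive.

Import GRing.Theory.
Local Open Scope ring_scope.

(* MathComp rings are associative, so a not necessarily associative
   F-algebra is given by an F-module together with a product on it. *)
Section NonassociativeAlgebras.

Variable F : fieldType.

Definition nonassoc_algebra (A : lmodType F) (mul : A -> A -> A) : Prop :=
  bilinear_for *:%R *:%R mul.

Definition alternative (A : Type) (mul : A -> A -> A) : Prop :=
  (forall x y, mul (mul x x) y = mul x (mul x y)) /\
  (forall x y, mul (mul x y) y = mul x (mul y y)).

Definition unital_alternative_algebra
    (A : lmodType F) (mul : A -> A -> A) (one : A) : Prop :=
  [/\ nonassoc_algebra mul, alternative mul,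
      left_id one mul & right_id one mul].

Definition M2_embedding (A : lmodType F) (mul : A -> A -> A) (one : A)
    (phi : 'M[F]_2 -> A) : Prop :=
  [/\ linear phi, {morph phi : M N / M *m N >-> mul M N},
      phi 1%:M = one & injective phi].

Definition unital_algebra_iso
    (A : lmodType F) (mulA : A -> A -> A) (oneA : A)
    (A' : lmodType F) (mulA' : A' -> A' -> A') (oneA' : A')
    (h : A -> A') : Prop :=
  [/\ linear h, {morph h : x y / mulA x y >-> mulA' x y},
      h oneA = oneA' & bijective h].

End NonassociativeAlgebras.

(* A unital module over the F-algebra B, seen as an F-module. *)
Definition restrict_scalars (F : fieldType) (B : algType F) (V : lmodType B) :
  Type := V.

Section RestrictScalars.

Variables (F : fieldType) (B : algType F) (V : lmodType B).

HB.instance Definition _ := GRing.Zmodule.copy (restrict_scalars V) V.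

Let scale (k : F) (v : restrict_scalars V) : restrict_scalars V :=
  (k%:A : B) *: (v : V).

Fact restrict_scalersA a b v : scale a (scale b v) = scale (a * b) v.
Proof. by rewrite /scale scalerA -scalerAl mul1r scalerA. Qed.

Fact restrict_scaler1 : left_id 1 scale.
Proof. by move=> v; rewrite /scale !scale1r. Qed.

Fact restrict_scalersDr : right_distributive scale +%R.
Proof. by move=> k u v; rewrite /scale scalerDr. Qed.

Fact restrict_scalersDl v : {morph scale^~ v : a b / a + b}.
Proof. by move=> a b; rewrite /scale !scalerDl. Qed.

HB.instance Definition _ := GRing.Zmodule_isLmodule.Build F
  (restrict_scalars V) restrict_scalersA restrict_scaler1
  restrict_scalersDr restrict_scalersDl.

End RestrictScalars.

Section Construction.

Variables (F : fieldType) (B : algType F) (V : lmodType B).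

Definition commutator_span (c : B) : Prop :=
  exists s : seq (F * (B * B)),
    c = \sum_(t <- s) t.1 *: (t.2.1 * t.2.2 - t.2.2 * t.2.1).

Definition commutators_annihilate : Prop :=
  forall (c : B) (v : V), commutator_span c -> c *: v = 0.

Definition in_center (z : B) : Prop := forall b : B, GRing.comm z b.

(* The first clause is biadditivity together with
   <b u, v> = b <u, v> = <u, b v>. *)
Definition alg_bilinear (f : V -> V -> B) : Prop :=
  bilinear_for *%R *%R f /\
  bilinear_for *:%R *:%R
    (f : restrict_scalars V -> restrict_scalars V -> B).

Definition skew_symmetric (f : V -> V -> B) : Prop := forall v, f v v = 0.

Definition admissible_form (f : V -> V -> B) : Prop :=
  [/\ alg_bilinear f, skew_symmetric f, forall u v, in_center (f u v) &
      forall u v w, f u v *: w + f v w *: u + f w u *: v = 0].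

Definition mx2 (a b c d : B) : 'M[B]_2 :=
  \matrix_(i, j) if i == 0 then (if j == 0 then a else b)
                 else (if j == 0 then c else d).

Definition mx2_star (M : 'M[B]_2) : 'M[B]_2 :=
  mx2 (M 1 1) (- M 0 1) (- M 1 0) (M 0 0).

(* The row (x, y) times M, with V a commutative bimodule: v . b = b *: v. *)
Definition rowmul (u : V * V) (M : 'M[B]_2) : V * V :=
  (M 0 0 *: u.1 + M 1 0 *: u.2, M 0 1 *: u.1 + M 1 1 *: u.2).

Definition M2V2 : lmodType F :=
  restrict_scalars ('M[B]_2 * (V * V))%type.

Definition M2V2_mul (f : V -> V -> B) (X Y : M2V2) : M2V2 :=
  let: (Xa, (x, y)) := X in
  let: (Ya, (z, t)) := Y in
  (Xa *m Ya + mx2 (- f x t) (- f y t) (f x z) (f y z),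
   rowmul (z, t) Xa + rowmul (x, y) (mx2_star Ya)).

Definition M2V2_one : M2V2 := (1%:M, (0, 0)).

Definition M2V2_incl (M : 'M[F]_2) : M2V2 := (map_mx (in_alg B) M, (0, 0)).

End Construction.

(* Main.v *)
Require Import Defs.
From HB Require Import structures.
From mathcomp Require Import all_boot all_order all_algebra.
From mathcomp Require Import sesquilinear.

Set Implicit Arguments.
Unset Strict Implicit.
Unset Printing Implicit Defensive.

Import GRing.Theory.
Local Open Scope ring_scope.

(** Part (1) is a computation in coordinates: both alternative laws reduce to
    identities between the four matrix entries and the two vector entries, and
    these hold because B is associative, B acts on V through a commutative
    quotient, the form is central, alternating and bilinear, and the cyclic sum
    <u,v>w + <v,w>u + <w,u>v vanishes.

    For part (2), let e11, e12, e21, e22 be the matrix units in A and let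
    A = A11 + A12 + A21 + A22 be the Peirce decomposition for e11. In an
    alternative algebra the products of the A_ij are those of block matrices,
    except that A12 A12 lies in A21 and A21 A21 in A12. The model determines
    where its ingredients must sit in A: B e11 is A11; the vectors (v, 0) are
    the elements of A12 killed by right multiplication with e21; and
    (v, 0) (z, 0) = <v, z> e21 makes <v, z> equal to e12 (v z). So we define
    B := A11, V := {v in A12 | v e21 = 0} and <v, z> := e12 (v z).

    One mechanism drives almost every proof: an associator changes only its
    sign under permutations of its arguments, so (x y) z = x (y z) follows as
    soon as both bracketings of some permutation of x, y, z vanish for Peirce
    reasons. This makes A12 an A11-module (assoc_11_11_12); as b |-> b e12 has
    the left inverse y |-> y e21 on A11, associativity of A11 follows
    (cornerA). Each b in A11 has a copy in A22, namely e21 (b e12), and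
    v copy(b) = b v on V; as left multiplication by A11 and right
    multiplication by A22 commute on A12, commutators of B kill V
    (corner_inV_comm). The identity for the cyclic sum is the alternation of
    the associator of e12 x, z, y (vform_jacobi).

    Finally A12 = A11 e12 + V, A21 = e21 A11 + e12 V and A22 = copy(A11), so
    the six coordinates (b_ij, (x, y)) parametrize A bijectively by
    b11 + b12 e12 + e21 b21 + copy(b22) + x + e12 y, and the multiplication
    table of these six kinds of summands is that of M2(B) + V^2
    (coordinate_product). *)

(** * Identities in abelian groups *)

(** The terms of a reflexive decision procedure: an identity between sums and
    opposites holds in every abelian group once the integer coefficients of
    each atom agree on both sides. *)
Inductive zexpr := ZAtom of nat | ZZero | ZOpp of zexpr | ZAdd of zexpr & zexpr.

Section AbelianGroupIdentities.
Variables (V : zmodType) (env : seq V).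

Fixpoint zeval t : V :=
  match t with
  | ZAtom n => env`_n
  | ZZero => 0
  | ZOpp s => - zeval s
  | ZAdd s s' => zeval s + zeval s'
  end.

Fixpoint zcoef t (n : nat) : int :=
  match t with
  | ZAtom m => (m == n)%:Z
  | ZZero => 0
  | ZOpp s => - zcoef s n
  | ZAdd s s' => zcoef s n + zcoef s' n
  end.

Lemma zevalE t : zeval t = \sum_(i < size env) env`_i *~ zcoef t i.
Proof.
elim: t => [m||s IHs|s IHs s' IHs'] /=; rewrite ?IHs ?IHs'.
- have [ltm|lem] := ltnP m (size env).
    rewrite (bigD1 (Ordinal ltm)) //= eqxx mulr1z big1 ?addr0 // => i.
    by rewrite -val_eqE /= eq_sym => /negbTE->; rewrite mulr0z.
  rewrite nth_default // big1 // => i _.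
  by rewrite gtn_eqF ?mulr0z // (leq_trans (ltn_ord i)).
- by rewrite big1 // => i _; rewrite mulr0z.
- by rewrite -sumrN; apply: eq_bigr => i _; rewrite mulrNz.
- by rewrite -big_split; apply: eq_bigr => i _; rewrite mulrzDr.
Qed.

Lemma zeval_eq s t :
  all (fun n => zcoef s n == zcoef t n) (iota 0 (size env)) ->
  zeval s = zeval t.
Proof.
move=> /allP eq_st; rewrite !zevalE; apply: eq_bigr => i _.
by congr (_ *~ _); apply/eqP/eq_st; rewrite mem_iota /=.
Qed.

End AbelianGroupIdentities.

(* Atoms are compared up to conversion, not syntactically: equal products are
   often elaborated along different paths of the algebraic hierarchy. *)
Ltac zmem x env :=
  match env with
  | nil => constr:(false)
  | cons ?y _ => let same := constr:(erefl x : x = y) in constr:(true)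
  | cons _ ?env' => zmem x env'
  end.
Ltac zatoms t env :=
  match t with
  | ?a + ?b => let env' := zatoms a env in zatoms b env'
  | - ?a => zatoms a env
  | 0 => env
  | _ => match zmem t env with true => env | false => constr:(cons t env) end
  end.
Ltac zindex x env :=
  match env with
  | cons ?y _ => let same := constr:(erefl x : x = y) in constr:(O)
  | cons _ ?env' => let n := zindex x env' in constr:(S n)
  end.
Ltac zreify t env :=
  match t with
  | ?a + ?b => let a' := zreify a env in let b' := zreify b env in
               constr:(ZAdd a' b')
  | - ?a => let a' := zreify a env in constr:(ZOpp a')
  | 0 => constr:(ZZero)
  | _ => let n := zindex t env in constr:(ZAtom n)
  end.
Ltac zmod :=
  match goal with |- @eq ?V ?s ?t =>
    let env := zatoms s (@nil V) in
    let env := zatoms t env in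
    let s' := zreify s env in
    let t' := zreify t env in
    exact: (@zeval_eq _ env s' t' isT)
  end.

(** * The algebra M2(B) + V^2 is alternative *)

Section ConstructionIsAlternative.
Variables (F : fieldType) (B : algType F) (V : lmodType B) (f : V -> V -> B).
Hypotheses (annV : commutators_annihilate V) (fP : admissible_form f).

Lemma scalerCA a b (v : V) : a *: (b *: v) = b *: (a *: v).
Proof.
apply/eqP; rewrite -subr_eq0 !scalerA -scalerBl; apply/eqP/annV.
by exists [:: (1, (a, b))]; rewrite big_seq1 scale1r.
Qed.

Lemma form_linearl u : linear_for *%R (f^~ u).
Proof. by case: fP => -[[fl _] _] _ _ _; apply: fl. Qed.
Lemma form_linearr u : linear_for *%R (f u).
Proof. by case: fP => -[[_ fr] _] _ _ _; apply: fr. Qed.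

Lemma form0l v : f 0 v = 0.
Proof.
by have := form_linearl v (-1) 0 0; rewrite /= scaler0 addr0 mulN1r addNr.
Qed.
Lemma form0r v : f v 0 = 0.
Proof.
by have := form_linearr v (-1) 0 0; rewrite /= scaler0 addr0 mulN1r addNr.
Qed.
Lemma formDl u v w : f (u + v) w = f u w + f v w.
Proof. by have := form_linearl w 1 u v; rewrite /= scale1r mul1r. Qed.
Lemma formDr u v w : f w (u + v) = f w u + f w v.
Proof. by have := form_linearr w 1 u v; rewrite /= scale1r mul1r. Qed.
Lemma formZl a u w : f (a *: u) w = a * f u w.
Proof. by have := form_linearl w a u 0; rewrite /= form0l !addr0. Qed.
Lemma formZr a u w : f w (a *: u) = a * f w u.
Proof. by have := form_linearr w a u 0; rewrite /= form0r !addr0. Qed.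
Lemma formNl u w : f (- u) w = - f u w.
Proof. by rewrite -scaleN1r formZl mulN1r. Qed.
Lemma formNr u w : f w (- u) = - f w u.
Proof. by rewrite -scaleN1r formZr mulN1r. Qed.
Lemma formvv v : f v v = 0. Proof. by case: fP. Qed.
Lemma formC u v : f v u = - f u v.
Proof.
apply/eqP; rewrite -addr_eq0; apply/eqP; rewrite -(formvv (u + v)).
by rewrite formDl !formDr !formvv; zmod.
Qed.
Lemma form_central u v b : f u v * b = b * f u v.
Proof. by case: fP => _ _ c _; apply: c. Qed.
(** Oriented to eliminate a chosen form value from a vector. *)
Lemma form_jacobi u v w : f u v *: w = - (f v w *: u + f w u *: v).
Proof.
by apply/eqP; rewrite -addr_eq0 addrA; apply/eqP; case: fP => _ _ _; apply.
Qed.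

Lemma mx2D (a b c d a' b' c' d' : B) :
  mx2 a b c d + mx2 a' b' c' d' = mx2 (a + a') (b + b') (c + c') (d + d').
Proof. by apply/matrixP => i j; rewrite !mxE; do 2!case: ifP => _. Qed.

Lemma mx2M (a b c d a' b' c' d' : B) :
  mx2 a b c d *m mx2 a' b' c' d' =
  mx2 (a * a' + b * c') (a * b' + b * d') (c * a' + d * c') (c * b' + d * d').
Proof.
apply/matrixP => i j; rewrite !mxE 2!big_ord_recl big_ord0 !mxE /= addr0.
by do 2!case: ifP => _.
Qed.

Lemma mx2_eta (M : 'M[B]_2) : M = mx2 (M 0 0) (M 0 1) (M 1 0) (M 1 1).
Proof.
apply/matrixP => i j; rewrite mxE.
case: i j => [[|[|//]] ?] [[|[|//]] ?] /=; congr (M _ _); exact: val_inj.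
Qed.

Lemma M2V2P (X : M2V2 V) : exists a b c d x y, X = (mx2 a b c d, (x, y)).
Proof. by case: X => M [x y]; rewrite [M]mx2_eta; do 6!eexists. Qed.

Lemma M2V2_mulE a b c d (x y : V) a' b' c' d' (z t : V) :
  M2V2_mul f (mx2 a b c d, (x, y)) (mx2 a' b' c' d', (z, t)) =
  (mx2 (a * a' + b * c' - f x t) (a * b' + b * d' - f y t)
       (c * a' + d * c' + f x z) (c * b' + d * d' + f y z),
   (a *: z + c *: t + (d' *: x - c' *: y),
    b *: z + d *: t + (a' *: y - b' *: x))).
Proof.
rewrite /M2V2_mul mx2M mx2D /rowmul /mx2_star !mxE /=.
by rewrite !scaleNr [- _ + _]addrC.
Qed.

(* Form values are moved to the right of the scalars, so that words in B have
   one normal form. *)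
Ltac expand := rewrite ?(mulrDl, mulrDr, mulNr, mulrN, scalerDl, scalerDr,
  scaleNr, scalerN, formDl, formDr, formNl, formNr, formZl, formZr,
  form_central, mulrA, formvv, opprD, opprK, scale0r, mulr0, mul0r, scaler0).

(* Scalars acting on a vector commute; they are sorted as in the list l. *)
Ltac swap_after b l :=
  match l with
  | (?l', ?a) => rewrite ?(scalerCA b a); swap_after b l'
  | ?a => rewrite ?(scalerCA b a)
  end.
Ltac sort_scalars l :=
  match l with
  | (?l', ?b) => swap_after b l'; sort_scalars l'
  | _ => idtac
  end.

Ltac normalize formE jacE scalars :=
  expand; rewrite -?scalerA ?formE; expand; rewrite ?jacE; expand;
  rewrite ?formE; expand; sort_scalars scalars.

Lemma M2V2_left_alternative X Y :
  M2V2_mul f (M2V2_mul f X X) Y = M2V2_mul f X (M2V2_mul f X Y).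
Proof.
have [a [b [c [d [x [y ->]]]]]] := M2V2P X.
have [a' [b' [c' [d' [z [t ->]]]]]] := M2V2P Y; rewrite !M2V2_mulE.
(* The form value of the repeated pair x, y is the one to eliminate. *)
have formE := (formC x y, formC x z, formC x t, formC y z, formC y t).
have jacE := (form_jacobi x y z, form_jacobi x y t).
congr (mx2 _ _ _ _, (_, _)); normalize formE jacE (a,b,c,d,a',b',c',d'); zmod.
Qed.

Lemma M2V2_right_alternative X Y :
  M2V2_mul f (M2V2_mul f X Y) Y = M2V2_mul f X (M2V2_mul f Y Y).
Proof.
have [a [b [c [d [x [y ->]]]]]] := M2V2P X.
have [a' [b' [c' [d' [z [t ->]]]]]] := M2V2P Y; rewrite !M2V2_mulE.
have formE := (formC x z, formC x t, formC y z, formC y t, formC z t).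
have jacE := (form_jacobi z t x, form_jacobi z t y).
congr (mx2 _ _ _ _, (_, _)); normalize formE jacE (a,b,c,d,a',b',c',d'); zmod.
Qed.

Lemma mx2Z k (a b c d : B) :
  k *: mx2 a b c d = mx2 (k * a) (k * b) (k * c) (k * d).
Proof. by apply/matrixP => i j; rewrite !mxE; do 2!case: ifP => _. Qed.

(** One step of linear combination in coordinates, which makes both linearity
    statements below coordinatewise. *)
Lemma M2V2_linE k a b c d (x y : V) a' b' c' d' (z t : V) :
  k *: ((mx2 a b c d, (x, y)) : M2V2 V) + (mx2 a' b' c' d', (z, t)) =
  (mx2 (k%:A * a + a') (k%:A * b + b') (k%:A * c + c') (k%:A * d + d'),
   (k%:A *: x + z, k%:A *: y + t)).
Proof. by rewrite -mx2D -mx2Z. Qed.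

Lemma M2V2_bilinear : nonassoc_algebra (M2V2_mul f).
Proof.
have kC k (a : B) : a * k%:A = k%:A * a.
  by rewrite -scalerAr mulr1 -scalerAl mul1r.
split=> X k Y Z; have [a [b [c [d [x [y ->]]]]]] := M2V2P X;
  have [a' [b' [c' [d' [z [t ->]]]]]] := M2V2P Y;
  have [a'' [b'' [c'' [d'' [z' [t' ->]]]]]] := M2V2P Z;
  rewrite !(M2V2_linE, M2V2_mulE); move: (k%:A) (kC k) => {}k {}kC;
  have kE := (kC a, kC b, kC c, kC d);
  by congr (mx2 _ _ _ _, (_, _)); normalize kE kE (k,a,b,c,d); zmod.
Qed.

Lemma M2V2_mul1 : left_id (M2V2_one V) (M2V2_mul f).
Proof.
move=> [M [x y]]; rewrite /M2V2_mul /M2V2_one /rowmul !form0l !oppr0 !mul1mx.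
rewrite !mxE /=.
rewrite !scaler0 !scale0r !scale1r !(addr0, add0r).
by congr (_, _); apply/matrixP => i j; rewrite !mxE !if_same addr0.
Qed.

Lemma M2V2_mulr1 : right_id (M2V2_one V) (M2V2_mul f).
Proof.
move=> [M [x y]]; rewrite /M2V2_mul /M2V2_one /rowmul !form0r !oppr0 !mulmx1.
rewrite !mxE /= ?mxE.
rewrite !scaler0 !scaleNr !scale0r !scale1r !oppr0 !(addr0, add0r).
by congr (_, _); apply/matrixP => i j; rewrite !mxE !if_same addr0.
Qed.

Lemma M2V2_incl_embedding :
  M2_embedding (M2V2_mul f) (M2V2_one V) (M2V2_incl V).
Proof.
split.
- move=> k M N; congr (_, (_, _)); last first.
  + by rewrite /= scaler0 addr0.
  + by rewrite /= scaler0 addr0.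
  rewrite /= raddfD; congr (_ + _).
  by apply/matrixP => i j; rewrite !mxE /= -scalerAl mul1r scalerA.
- move=> M N; rewrite /M2V2_mul /M2V2_incl /rowmul map_mxM form0l.
  rewrite !scaler0 !addr0 !oppr0; congr (_, _).
  by apply/matrixP => i j; rewrite !mxE !if_same addr0.
- by rewrite /M2V2_incl map_mx1.
- move=> M N [] MN; apply/matrixP => i j.
  by move/matrixP/(_ i j): MN; rewrite !mxE => /fmorph_inj.
Qed.

Lemma M2V2_construction :
  unital_alternative_algebra (M2V2_mul f) (M2V2_one V) /\
  M2_embedding (M2V2_mul f) (M2V2_one V) (M2V2_incl V).
Proof.
split; last exact: M2V2_incl_embedding.
split; [exact: M2V2_bilinear| |exact: M2V2_mul1|exact: M2V2_mulr1].
by split; [exact: M2V2_left_alternative|exact: M2V2_right_alternative].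
Qed.
End ConstructionIsAlternative.

(** * Alternative algebras *)

Record alt_algebra (F : fieldType) := AltAlgebra {
  alt_sort :> lmodType F;
  alt_mul : alt_sort -> alt_sort -> alt_sort;
  alt_one : alt_sort;
  alt_algebraP : unital_alternative_algebra alt_mul alt_one
}.

Reserved Notation "x ** y" (at level 40, left associativity).
Local Notation "x ** y" := (alt_mul x y).

Section AlternativeAlgebra.
Variables (F : fieldType) (A : alt_algebra F).
Implicit Types x y z : A.

Lemma altlP z : linear (fun x => x ** z).
Proof. by move=> k x y; case: (alt_algebraP A) => -[bl _] _ _ _; apply: bl. Qed.
Lemma altrP z : linear (alt_mul z).
Proof. by move=> k x y; case: (alt_algebraP A) => -[_ br] _ _ _; apply: br. Qed.
Lemma alt0l z : 0 ** z = 0 :> A.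
Proof. by have := altlP z (-1) 0 0; rewrite scaler0 addr0 scaleN1r addNr. Qed.
Lemma alt0r z : z ** 0 = 0 :> A.
Proof. by have := altrP z (-1) 0 0; rewrite scaler0 addr0 scaleN1r addNr. Qed.
Lemma altDl x y z : (x + y) ** z = x ** z + y ** z.
Proof. by have := altlP z 1 x y; rewrite !scale1r. Qed.
Lemma altDr x y z : z ** (x + y) = z ** x + z ** y.
Proof. by have := altrP z 1 x y; rewrite !scale1r. Qed.
Lemma altZl k x z : (k *: x) ** z = k *: (x ** z).
Proof. by have := altlP z k x 0; rewrite alt0l !addr0. Qed.
Lemma altZr k x z : z ** (k *: x) = k *: (z ** x).
Proof. by have := altrP z k x 0; rewrite alt0r !addr0. Qed.
Lemma altNl x z : (- x) ** z = - (x ** z).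
Proof. by rewrite -scaleN1r altZl scaleN1r. Qed.
Lemma altNr x z : z ** (- x) = - (z ** x).
Proof. by rewrite -scaleN1r altZr scaleN1r. Qed.
Lemma altMnl n x z : (x *+ n) ** z = (x ** z) *+ n.
Proof. by elim: n => [|n IH]; rewrite ?alt0l // !mulrS altDl IH. Qed.
Lemma altMnr n x z : z ** (x *+ n) = (z ** x) *+ n.
Proof. by elim: n => [|n IH]; rewrite ?alt0r // !mulrS altDr IH. Qed.

Lemma alt1 x : alt_one A ** x = x. Proof. by case: (alt_algebraP A). Qed.
Lemma altr1 x : x ** alt_one A = x. Proof. by case: (alt_algebraP A). Qed.
Lemma alt_xxy x y : (x ** x) ** y = x ** (x ** y).
Proof. by case: (alt_algebraP A) => _ [l _] _ _; apply: l. Qed.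
Lemma alt_yxx x y : (y ** x) ** x = y ** (x ** x).
Proof. by case: (alt_algebraP A) => _ [_ r] _ _; apply: r. Qed.

Definition associator x y z := (x ** y) ** z - x ** (y ** z).

Lemma ascE x y z : (x ** y) ** z = x ** (y ** z) + associator x y z.
Proof. by rewrite addrC subrK. Qed.

Lemma asc12 x y z : associator y x z = - associator x y z.
Proof.
apply/eqP; rewrite -addr_eq0 /associator; apply/eqP.
have := alt_xxy (x + y) z; rewrite !(altDl, altDr) !alt_xxy => /eqP.
rewrite -subr_eq0 => /eqP <-; zmod.
Qed.

Lemma asc23 x y z : associator x z y = - associator x y z.
Proof.
apply/eqP; rewrite -addr_eq0 /associator; apply/eqP.
have := alt_yxx (y + z) x; rewrite !(altDl, altDr) !alt_yxx => /eqP.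
rewrite -subr_eq0 => /eqP <-; zmod.
Qed.

Lemma alt_flex x y : (x ** y) ** x = x ** (y ** x).
Proof.
apply/eqP; rewrite -subr_eq0 -/(associator x y x) asc23 /associator alt_xxy.
by rewrite subrr oppr0.
Qed.

(** The difference of the two sides is the sum of the associators of x a, x, y
    and of x, a, x y. Alternating both turns it into the difference of two
    instances of the linearized right alternative law, for x^2 and for x. *)
Lemma left_moufang x a y : ((x ** a) ** x) ** y = x ** (a ** (x ** y)).
Proof.
suff h : associator (x ** a) x y + associator x a (x ** y) = 0.
  by rewrite ascE (ascE x a) -addrA [associator x a _ + _]addrC h addr0.
rewrite asc12 [associator x a _]asc23 -opprD.
have linr (p q r : A) :
    p ** q ** r + p ** r ** q = p ** (q ** r) + p ** (r ** q).
  by rewrite (ascE p q) (ascE p r) [associator p r q]asc23; zmod.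
have e1 := linr (x ** x) a y; have e2 := linr x a y.
rewrite /associator -!alt_xxy addrACA e1 !alt_xxy -opprD -!altDr e2 !altDr.
zmod.
Qed.

(** As the associator alternates, a triple associates as soon as one of its
    permutations does; in applications both sides of the premise vanish. *)
Lemma assoc12 x y z :
  (y ** x) ** z = y ** (x ** z) -> (x ** y) ** z = x ** (y ** z).
Proof. by move=> h; rewrite ascE asc12 /associator h subrr oppr0 addr0. Qed.
Lemma assoc23 x y z :
  (x ** z) ** y = x ** (z ** y) -> (x ** y) ** z = x ** (y ** z).
Proof. by move=> h; rewrite ascE asc23 /associator h subrr oppr0 addr0. Qed.
Lemma assoc13 x y z :
  (z ** y) ** x = z ** (y ** x) -> (x ** y) ** z = x ** (y ** z).
Proof. by move=> h; apply/assoc12/assoc23/assoc12. Qed.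
Lemma assoc_rot x y z :
  (y ** z) ** x = y ** (z ** x) -> (x ** y) ** z = x ** (y ** z).
Proof. by move=> h; apply/assoc12/assoc23. Qed.
Lemma assoc_rotr x y z :
  (z ** x) ** y = z ** (x ** y) -> (x ** y) ** z = x ** (y ** z).
Proof. by move=> h; apply/assoc23/assoc12. Qed.
End AlternativeAlgebra.

(** The opposite algebra turns left-hand statements into right-hand ones. *)
Fact alt_oppP F (A : alt_algebra F) :
  unital_alternative_algebra (fun x y : A => y ** x) (alt_one A).
Proof.
case: (alt_algebraP A) => -[bl br] [al ar] l r.
by split=> //; split=> x y /=; [rewrite ar | rewrite al].
Qed.
Definition alt_opp F (A : alt_algebra F) := AltAlgebra (alt_oppP A).

(** * Peirce decomposition *)

Section Peirce.
Variables (F : fieldType).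
Implicit Types (A : alt_algebra F) (i j k l : bool).

(** The booleans i and j are the left and right eigenvalues of e: the index 1 of
    the classical notation A_ij is true and the index 2 is false. *)
Definition peirce A (e : A) i j : pred A :=
  fun x => (e ** x == x *+ i) && (x ** e == x *+ j).

Lemma peirceP A (e : A) i j x :
  reflect (e ** x = x *+ i /\ x ** e = x *+ j) (peirce e i j x).
Proof. by apply: (iffP andP) => -[/eqP ? /eqP ?]. Qed.

Lemma peirce_submod_closed A (e : A) i j : submod_closed (peirce e i j).
Proof.
split=> [|k x y /peirceP[xi xj] /peirceP[yi yj]]; apply/peirceP.
  by rewrite alt0l alt0r !mul0rn.
by rewrite !(altDl, altDr, altZl, altZr) xi xj yi yj !mulrnDl !scalerMnr.
Qed.

Lemma peirceN A (e : A) i j x : peirce e i j x -> peirce e i j (- x).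
Proof.
by move=> /peirceP[xi xj]; apply/peirceP; rewrite altNl altNr xi xj !mulNrn.
Qed.

Lemma peirceD A (e : A) i j x y :
  peirce e i j x -> peirce e i j y -> peirce e i j (x + y).
Proof.
by have [_ /(_ 1 x y)] := peirce_submod_closed e i j; rewrite scale1r.
Qed.

Lemma peirce_opp A (e : A) i j x :
  peirce e i j x = peirce (A := alt_opp A) e j i x.
Proof. exact: andbC. Qed.

Lemma peirce_compl A (e : A) i j x :
  peirce e i j x -> peirce (alt_one A - e) (~~ i) (~~ j) x.
Proof.
move=> /peirceP[xi xj]; apply/peirceP.
rewrite altDl altDr altNl altNr alt1 altr1.
by rewrite xi xj; case: i j {xi xj} => [] []; rewrite ?(subr0, subrr).
Qed.

(** The associator of x, e, y is known on Peirce components, and moving e to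
    either end gives the action of e on x y. *)
Lemma peirce_mulE A (e : A) i j k l x y : peirce e i j x -> peirce e k l y ->
  e ** (x ** y) = x ** y *+ i + (x ** y *+ j - x ** y *+ k) /\
  (x ** y) ** e = x ** y *+ l - (x ** y *+ j - x ** y *+ k).
Proof.
move=> /peirceP[xi xj] /peirceP[yk yl].
have mid : associator x e y = x ** y *+ j - x ** y *+ k.
  by rewrite /associator xj yk altMnl altMnr.
split.
  by rewrite -mid -altMnl -xi ascE asc12; zmod.
by rewrite -mid -altMnr -yl ascE asc23; zmod.
Qed.

Lemma peirce_mul A (e : A) i j l x y :
  peirce e i j x -> peirce e j l y -> peirce e i l (x ** y).
Proof.
move=> hx hy; have [l1 l2] := peirce_mulE hx hy; apply/peirceP.
by rewrite l1 l2 subrr addr0 subr0.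
Qed.

Lemma peirce_sqr A (e : A) i x y :
  peirce e i (~~ i) x -> peirce e i (~~ i) y -> peirce e (~~ i) i (x ** y).
Proof.
move=> hx hy; have [l1 l2] := peirce_mulE hx hy; apply/peirceP.
by rewrite l1 l2; split; zmod.
Qed.

(** The eigenvalue computation only gives 2 x y = 0 here; the Moufang identity
    also covers characteristic 2. *)
Lemma peirce_mul0_left A (e : A) l x y :
  peirce e true true x -> peirce e false l y -> x ** y = 0.
Proof.
move=> /peirceP[ex xe] /peirceP[ey _].
by have := left_moufang e x y; rewrite ex mulr1n xe mulr1n ey mulr0n !alt0r.
Qed.

(** Exchanging e with 1 - e and passing to the opposite algebra reduce every
    case to the previous lemma. *)
Lemma peirce_mul0 A (e : A) i j k l x y :
  peirce e i j x -> peirce e k l y -> (j != k) && ((i != k) || (j != l)) ->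
  x ** y = 0.
Proof.
have right A' (e' : A') i' x' y' :
    peirce e' i' true x' -> peirce e' false false y' -> x' ** y' = 0.
  move=> hx hy; have hx' := peirce_compl hx; have hy' := peirce_compl hy.
  rewrite peirce_opp in hx'; rewrite peirce_opp in hy'.
  exact: (peirce_mul0_left hy' hx').
move=> hx hy; have hx' := peirce_compl hx; have hy' := peirce_compl hy.
case: i j k l hx hy hx' hy' => [] [] [] [] //= hx hy hx' hy' _;
 by [apply: peirce_mul0_left hx hy | apply: peirce_mul0_left hx' hy'
   | apply: right hx hy | apply: right hx' hy'].
Qed.
End Peirce.

(** * Matrix units in an alternative algebra *)

Record M2_alt_algebra (F : fieldType) := M2AltAlgebra {
  M2_base :> alt_algebra F;
  M2_emb : 'M[F]_2 -> M2_base;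
  M2_embP : M2_embedding (@alt_mul _ M2_base) (alt_one M2_base) M2_emb
}.

Section MatrixUnits.
Variables (F : fieldType) (D : M2_alt_algebra F).

Definition e11 : D := M2_emb D (delta_mx 0 0).
Definition e12 : D := M2_emb D (delta_mx 0 1).
Definition e21 : D := M2_emb D (delta_mx 1 0).
Definition e22 : D := M2_emb D (delta_mx 1 1).

Lemma M2_emb_additive : {morph M2_emb D : M N / M + N}.
Proof.
by move=> M N; case: (M2_embP D) => l _ _ _; have := l 1 M N; rewrite !scale1r.
Qed.

Lemma M2_emb0 : M2_emb D 0 = 0.
Proof. by apply: (addrI (M2_emb D 0)); rewrite -M2_emb_additive !addr0. Qed.

Lemma mul_units i j k l :
  M2_emb D (delta_mx i j) ** M2_emb D (delta_mx k l) =
  M2_emb D (delta_mx i l *+ (j == k)).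
Proof. by case: (M2_embP D) => _ m _ _; rewrite -m mul_delta_mx_cond. Qed.

Lemma e11_e11 : e11 ** e11 = e11. Proof. by rewrite mul_units eqxx. Qed.
Lemma e11_e12 : e11 ** e12 = e12. Proof. by rewrite mul_units eqxx. Qed.
Lemma e12_e21 : e12 ** e21 = e11. Proof. by rewrite mul_units eqxx. Qed.
Lemma e21_e12 : e21 ** e12 = e22. Proof. by rewrite mul_units eqxx. Qed.
Lemma e21_e11 : e21 ** e11 = e21. Proof. by rewrite mul_units eqxx. Qed.
Lemma e12_e12 : e12 ** e12 = 0. Proof. by rewrite mul_units M2_emb0. Qed.
Lemma e21_e21 : e21 ** e21 = 0. Proof. by rewrite mul_units M2_emb0. Qed.
Lemma e11_e22 : e11 + e22 = alt_one D.
Proof.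
case: (M2_embP D) => _ _ <- _; rewrite -M2_emb_additive mx1_sum_delta.
rewrite !big_ord_recl big_ord0 addr0.
by congr (M2_emb D (_ + delta_mx _ _)); exact: val_inj.
Qed.
Lemma e11_neq0 : e11 != 0.
Proof.
apply/eqP; rewrite -M2_emb0; case: (M2_embP D) => _ _ _ inj /inj.
move=> /matrixP /(_ 0 0).
by rewrite !mxE eqxx; apply/eqP/oner_neq0.
Qed.

Lemma e11P : peirce e11 true true e11.
Proof. by apply/peirceP; rewrite e11_e11. Qed.
Lemma e12P : peirce e11 true false e12.
Proof. by apply/peirceP; rewrite e11_e12 mul_units M2_emb0. Qed.
Lemma e21P : peirce e11 false true e21.
Proof. by apply/peirceP; rewrite e21_e11 mul_units M2_emb0. Qed.
Lemma e22P : peirce e11 false false e22.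
Proof. by apply/peirceP; rewrite !mul_units M2_emb0. Qed.

(** The vectors (v, 0) of the model. *)
Definition inV : pred D := fun v => peirce e11 true false v && (v ** e21 == 0).
Lemma inVP v : inV v -> peirce e11 true false v. Proof. by case/andP. Qed.
Lemma inV_e21 v : inV v -> v ** e21 = 0. Proof. by case/andP => _ /eqP. Qed.
End MatrixUnits.

Arguments e11 {F D}.
Arguments e12 {F D}.
Arguments e21 {F D}.
Arguments e22 {F D}.
Arguments e11P {F D}.
Arguments e12P {F D}.
Arguments e21P {F D}.
Arguments e22P {F D}.

(* ptype returns a proof that t lies in some Peirce component, read off from its
   factors and from the hypotheses. *)
Ltac ptype t :=
  lazymatch t with
  | @e11 ?F ?D => constr:(@e11P F D)
  | @e12 ?F ?D => constr:(@e12P F D)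
  | @e21 ?F ?D => constr:(@e21P F D)
  | @e22 ?F ?D => constr:(@e22P F D)
  | @alt_mul _ _ ?x ?y =>
      let hx := ptype x in let hy := ptype y in
      match t with
      | _ => constr:(peirce_mul hx hy)
      | _ => constr:(peirce_sqr hx hy)
      end
  | ?x + ?y => let hx := ptype x in let hy := ptype y in
      constr:(peirceD hx hy)
  | - ?x => let hx := ptype x in constr:(peirceN hx)
  | _ => match goal with
         | h : is_true (peirce _ _ _ t) |- _ => constr:(h)
         | h : is_true (inV t) |- _ => constr:(inVP h)
         end
  end.
Ltac ptyped := match goal with |- is_true (peirce _ _ _ ?t) =>
  let h := ptype t in exact: h end.
(* Erases the products that vanish by the Peirce relations. *)
Ltac pzero := repeat (match goal with |- context [@alt_mul _ _ ?x ?y] =>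
  let hx := ptype x in let hy := ptype y in
  rewrite (peirce_mul0 hx hy isT) end; rewrite ?(alt0l, alt0r)).
(* Associates three factors by finding a permutation of them of which both
   bracketings vanish. *)
Ltac passoc :=
  first [ apply: assoc12; by pzero | apply: assoc23; by pzero
        | apply: assoc13; by pzero | apply: assoc_rot; by pzero
        | apply: assoc_rotr; by pzero ].

(* Applies an alternation e of associators and erases what vanishes in it. *)
Ltac swap_asc e :=
  have := e; rewrite /associator; pzero; rewrite ?(subr0, sub0r, opprK).

(** * The coordinate ring, the module and the form *)

Section CoordinateRing.
Variables (F : fieldType) (D : M2_alt_algebra F).
Local Notation P := (peirce (@e11 F D)).
Implicit Types a b v x y z : D.

Lemma mul_e11l j x : P true j x -> e11 ** x = x. Proof. by case/peirceP. Qed.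

Lemma mul_e11r i x : P i true x -> x ** e11 = x. Proof. by case/peirceP. Qed.

Lemma mul_e22l j x : P false j x -> e22 ** x = x.
Proof.
move=> hx; rewrite -{2}(alt1 x) -e11_e22 altDl.
by case/peirceP: hx => -> _; rewrite add0r.
Qed.

Lemma mul_e22r i x : P i false x -> x ** e22 = x.
Proof.
move=> hx; rewrite -{2}(altr1 x) -e11_e22 altDr.
by case/peirceP: hx => _ ->; rewrite add0r.
Qed.

Lemma assoc_11_11_12 a b y : P true true a -> P true true b -> P true false y ->
  a ** b ** y = a ** (b ** y).
Proof. by move=> ha hb hy; passoc. Qed.

(** The injectivity of b |-> b e12 on A11, in the form of a left inverse. *)
Lemma corner_e12_e21 a : P true true a -> a ** e12 ** e21 = a.
Proof.
move=> ha; have -> : a ** e12 ** e21 = a ** (e12 ** e21) by passoc.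
by rewrite e12_e21 (mul_e11r ha).
Qed.

(** A11 acts faithfully on A11 e12, where three factors do associate. *)
Lemma cornerA a b c : P true true a -> P true true b -> P true true c ->
  a ** b ** c = a ** (b ** c).
Proof.
move=> ha hb hc.
have hab : P true true (a ** b) by ptyped.
have hbc : P true true (b ** c) by ptyped.
have hcu : P true false (c ** e12) by ptyped.
rewrite -[LHS]corner_e12_e21; last by ptyped.
rewrite -[RHS]corner_e12_e21; last by ptyped.
congr (_ ** e21); rewrite !assoc_11_11_12 //; exact: e12P.
Qed.

Lemma inV_corner a v : P true true a -> inV v -> inV (a ** v).
Proof.
move=> ha hv; apply/andP; split; first by ptyped.
have -> : a ** v ** e21 = a ** (v ** e21) by passoc.
by rewrite inV_e21 // alt0r.
Qed.

Lemma sq12 x : P true false x -> x ** x = 0.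
Proof.
move=> hx; have hxx : P false true (x ** x) by ptyped.
by rewrite -{2}(mul_e22r hx) -alt_xxy; pzero.
Qed.

Lemma skew12 x y : P true false x -> P true false y -> y ** x = - (x ** y).
Proof.
move=> hx hy; have hxy : P true false (x + y) by ptyped.
apply/eqP; rewrite -addr_eq0; have := sq12 hxy.
by rewrite altDl !altDr sq12 // (sq12 hy) addr0 add0r addrC => ->.
Qed.

Lemma sq21 x : P false true x -> x ** x = 0.
Proof.
move=> hx; have hxx : P true false (x ** x) by ptyped.
by rewrite -{2}(mul_e11r hx) -alt_xxy; pzero.
Qed.

Lemma skew21 x y : P false true x -> P false true y -> y ** x = - (x ** y).
Proof.
move=> hx hy; have hxy : P false true (x + y) by ptyped.
apply/eqP; rewrite -addr_eq0; have := sq21 hxy.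
by rewrite altDl !altDr sq21 // (sq21 hy) addr0 add0r addrC => ->.
Qed.

(** On A12 the scalars of A11 can be moved between the two factors, and by the
    next lemma they come out of the product on the right. *)
Lemma mul12_cornerl a x y : P true true a -> P true false x -> P true false y ->
  (a ** x) ** y = x ** (a ** y).
Proof. by move=> ha hx hy; swap_asc (asc12 x a y) => <-. Qed.

Lemma mul12_cornerr a x y : P true true a -> P true false x -> P true false y ->
  (x ** y) ** a = x ** (a ** y).
Proof. by move=> ha hx hy; swap_asc (asc23 x a y) => ->. Qed.

(** The element c = e21 v of A22 satisfies c e21 = 0 by flexibility, and
    right multiplication by e21 is injective on A22 since c = (c e21) e12. *)
Lemma e21_inV v : inV v -> e21 ** v = 0.
Proof.
move=> hv; have h : P false false (e21 ** v) by ptyped.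
rewrite -(mul_e22r h) -e21_e12.
have <- : e21 ** v ** e21 ** e12 = e21 ** v ** (e21 ** e12) by passoc.
by rewrite alt_flex (inV_e21 hv) alt0r alt0l.
Qed.

Lemma e12_inV_e21 v : inV v -> (e12 ** v) ** e21 = - v.
Proof.
move=> hv; swap_asc (asc23 e12 e21 v).
by rewrite (e21_inV hv) alt0r ?subr0 e12_e21 (mul_e11l (inVP hv)).
Qed.

Lemma e21_e12_inV v : inV v -> e21 ** (e12 ** v) = v.
Proof. by move=> hv; rewrite skew21 ?e12_inV_e21 ?opprK //; ptyped. Qed.

(** The copy b e22 in A22 of the element b of A11. *)
Definition copy22 a : D := e21 ** (a ** e12).

Lemma copy22P a : P true true a -> P false false (copy22 a).
Proof. by move=> ha; rewrite /copy22; ptyped. Qed.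

(** The right action of A22 on V is the left action of A11: this is what makes
    V a commutative bimodule. *)
Lemma inV_copy22 b v : P true true b -> inV v -> v ** copy22 b = b ** v.
Proof.
move=> hb hv; have hbv := inV_corner hb hv; have hv12 := inVP hv.
swap_asc (asc23 v e21 (b ** e12)).
rewrite (inV_e21 hv) alt0l sub0r opprK => <-.
rewrite -mul12_cornerl // ?e12P //.
by rewrite (skew12 e12P (inVP hbv)) altNl e12_inV_e21 // opprK.
Qed.

(** The left action of a and the right action of the copy of b commute on
    A12. *)
Lemma corner_inV_comm a b v : P true true a -> P true true b -> inV v ->
  a ** (b ** v) = b ** (a ** v).
Proof.
move=> ha hb hv; have hc := copy22P hb; have hav := inV_corner ha hv.
rewrite -(inV_copy22 hb hv) -(inV_copy22 hb hav); apply: esym; passoc.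
Qed.

(** Read off from the model, where (v, 0) (z, 0) = <v, z> e21. *)
Definition vform v z : D := e12 ** (v ** z).

Lemma vformP v z : inV v -> inV z -> P true true (vform v z).
Proof. by move=> hv hz; rewrite /vform; ptyped. Qed.

Lemma vformDl u v z : vform (u + v) z = vform u z + vform v z.
Proof. by rewrite /vform altDl altDr. Qed.

Lemma vformDr u v z : vform z (u + v) = vform z u + vform z v.
Proof. by rewrite /vform !altDr. Qed.

(** The product v z is killed by e21 on the left, so it has no component in
    e12 V and equals its projection to e21 A11. *)
Lemma mul_inV v z : inV v -> inV z -> v ** z = e21 ** vform v z.
Proof.
move=> hv hz; have hvz : P false true (v ** z) by ptyped.
have h : e21 ** (v ** z) = 0.
  have := asc12 v e21 z.
  rewrite /associator (inV_e21 hv) (e21_inV hv) (e21_inV hz).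
  by rewrite alt0l alt0r subr0 oppr0 sub0r => /eqP; rewrite oppr_eq0 => /eqP.
swap_asc (asc12 e21 e12 (v ** z)).
rewrite h alt0r e21_e12 (mul_e22l hvz) oppr0 => /eqP.
by rewrite eq_sym oppr_eq0 subr_eq0 => /eqP.
Qed.

(** Associators are cyclic, and for factors in A12 their two halves lie in A22
    and A11, so each half is cyclic by itself. *)
Lemma cyclic12 x y z : P true false x -> P true false y -> P true false z ->
  (x ** y) ** z = (y ** z) ** x /\ x ** (y ** z) = y ** (z ** x).
Proof.
move=> hx hy hz.
have cyc : associator x y z = associator y z x by rewrite asc12 -asc23.
have e11D (p q : D) : P false false p -> P true true q -> e11 ** (p - q) = - q.
  by move=> hp hq; rewrite altDr altNr (mul_e11l hq); pzero; rewrite add0r.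
have h : x ** (y ** z) = y ** (z ** x).
  apply: oppr_inj; have := congr1 (alt_mul e11) cyc.
  by rewrite /associator !e11D //; ptyped.
by split=> //; move: cyc; rewrite /associator h => /addIr.
Qed.

(** A scalar travels through e12 (v z) by the mul12 lemmas and by cyclicity;
    that it arrives unchanged on the other side is the centrality of the form. *)
Lemma corner_form a v z : P true true a -> inV v -> inV z ->
  [/\ vform (a ** v) z = a ** vform v z, vform v (a ** z) = a ** vform v z
    & vform v z ** a = a ** vform v z].
Proof.
move=> ha hv hz; have hv12 := inVP hv; have hz12 := inVP hz.
have haz : P true false (a ** z) by ptyped.
have hau : P true false (a ** e12) by ptyped.
have h : vform v (a ** z) = a ** vform v z.
  rewrite /vform.
  have <- : a ** e12 ** (v ** z) = a ** (e12 ** (v ** z)) by passoc.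
  have [_ ->] := cyclic12 hau hv12 hz12.
  rewrite (skew12 hau hz12) mul12_cornerl ?e12P // altNr.
  have [_ ->] := cyclic12 hv12 e12P haz.
  by rewrite (skew12 hv12 haz) altNr opprK.
split=> //; rewrite -h /vform; first by rewrite mul12_cornerl.
by rewrite -(mul12_cornerr ha hv12 hz12); passoc.
Qed.

Lemma inV_form22 v z : inV v -> inV z -> (e12 ** v) ** z = copy22 (vform v z).
Proof.
move=> hv hz; have hf := vformP hv hz.
have [-> _] := cyclic12 e12P (inVP hv) (inVP hz).
by rewrite (mul_inV hv hz) /copy22; passoc.
Qed.

Lemma vform_skew v z : inV v -> inV z -> vform z v = - vform v z.
Proof.
by move=> hv hz; rewrite /vform (skew12 (inVP hv) (inVP hz)) altNr.
Qed.

Lemma inV_mul_e12_inV v z : inV v -> inV z -> v ** (e12 ** z) = - vform v z.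
Proof.
move=> hv hz; have [_ ->] := cyclic12 (inVP hv) e12P (inVP hz).
exact: vform_skew.
Qed.

Lemma e12_inV_corner a v : P true true a -> inV v ->
  (e12 ** v) ** a = e12 ** (a ** v).
Proof. by move=> ha hv; rewrite mul12_cornerr ?e12P ?inVP. Qed.

Lemma e21_corner_e12_inV a v : P true true a -> inV v ->
  (e21 ** a) ** (e12 ** v) = a ** v.
Proof.
move=> ha hv; swap_asc (asc23 e21 (e12 ** v) a).
by rewrite e12_inV_corner // e21_e12_inV ?inV_corner.
Qed.

Lemma e12_inV_e21_corner a v : P true true a -> inV v ->
  (e12 ** v) ** (e21 ** a) = - (a ** v).
Proof.
by move=> ha hv; rewrite skew21 ?e21_corner_e12_inV //; ptyped.
Qed.

(** What it says in the model that the associators of z, e12 x, y and of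
    e12 x, z, y are opposite. *)
Lemma vform_jacobi x y z : inV x -> inV y -> inV z ->
  vform x y ** z + vform y z ** x + vform z x ** y = 0.
Proof.
move=> hx hy hz; have hzy := vformP hz hy; have hxy := vformP hx hy.
have := asc12 (e12 ** x) z y; rewrite /associator; pzero.
rewrite (inV_mul_e12_inV hz hx) (inV_form22 hx hy) (mul_inV hz hy).
rewrite e12_inV_e21_corner //.
rewrite inV_copy22 // altNl (vform_skew hy hz) altNl !sub0r => /eqP.
by rewrite -addr_eq0 => /eqP h; apply: oppr_inj; rewrite oppr0 -h; zmod.
Qed.

Lemma e12_e12_mul (x : D) : e12 ** (e12 ** x) = 0.
Proof. by rewrite -alt_xxy e12_e12 alt0l. Qed.

(** The remaining entries of the multiplication table. In the names, M_ij stands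
    for the summand B e_ij of the matrix part, V12 for V and V21 for e12 V. *)
Lemma M12_M12 a b : P true true a -> P true true b ->
  (a ** e12) ** (b ** e12) = 0.
Proof.
move=> ha hb; have hab : P true true (a ** b) by ptyped.
have hbu : P true false (b ** e12) by ptyped.
rewrite mul12_cornerl ?e12P // -(assoc_11_11_12 ha hb e12P).
by rewrite -(mul12_cornerr hab e12P e12P) e12_e12 alt0l.
Qed.

Lemma M12_V12 a v : P true true a -> inV v -> (a ** e12) ** v = e12 ** (a ** v).
Proof. by move=> ha hv; rewrite mul12_cornerl ?e12P ?inVP. Qed.

Lemma V12_M12 a v : P true true a -> inV v ->
  v ** (a ** e12) = - (e12 ** (a ** v)).
Proof.
move=> ha hv; have hau : P true false (a ** e12) by ptyped.
by rewrite (skew12 hau (inVP hv)) M12_V12.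
Qed.

Lemma M12_M22 a b : P true true a -> P true true b ->
  (a ** e12) ** copy22 b = a ** b ** e12.
Proof.
move=> ha hb; swap_asc (asc12 (a ** e12) e21 (b ** e12)).
rewrite M12_M12 // alt0r oppr0 corner_e12_e21 // => /eqP.
by rewrite eq_sym oppr_eq0 subr_eq0 -(assoc_11_11_12 ha hb e12P) => /eqP.
Qed.

Lemma M12_M21 a b : P true true a -> P true true b ->
  (a ** e12) ** (e21 ** b) = a ** b.
Proof.
by move=> ha hb; rewrite -{2}(corner_e12_e21 ha); apply: esym; passoc.
Qed.

Lemma M12_V21 a v : P true true a -> inV v -> (a ** e12) ** (e12 ** v) = 0.
Proof.
move=> ha hv.
have -> : a ** e12 ** (e12 ** v) = a ** (e12 ** (e12 ** v)) by passoc.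
by rewrite e12_e12_mul alt0r.
Qed.

Lemma V12_M21 a v : P true true a -> inV v -> v ** (e21 ** a) = 0.
Proof.
move=> ha hv; have <- : v ** e21 ** a = v ** (e21 ** a) by passoc.
by rewrite inV_e21 ?alt0l.
Qed.

Lemma M21_M11 a b : P true true a -> P true true b ->
  (e21 ** a) ** b = e21 ** (a ** b).
Proof. by move=> ha hb; passoc. Qed.

Lemma M21_M12 a b : P true true a -> P true true b ->
  (e21 ** a) ** (b ** e12) = copy22 (a ** b).
Proof.
move=> ha hb; by rewrite /copy22 (assoc_11_11_12 ha hb e12P); passoc.
Qed.

Lemma M21_V12 a v : P true true a -> inV v -> (e21 ** a) ** v = 0.
Proof.
move=> ha hv; have -> : e21 ** a ** v = e21 ** (a ** v) by passoc.
by rewrite e21_inV ?inV_corner.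
Qed.

Lemma V21_M12 a v : P true true a -> inV v -> (e12 ** v) ** (a ** e12) = 0.
Proof.
move=> ha hv; have hau : P true false (a ** e12) by ptyped.
have hav := inV_corner ha hv.
have [-> _] := cyclic12 e12P (inVP hv) hau.
rewrite V12_M12 // altNl; have [-> _] := cyclic12 e12P (inVP hav) e12P.
by rewrite alt_yxx e12_e12 alt0r oppr0.
Qed.

Lemma M21_M21 a b : P true true a -> P true true b ->
  (e21 ** a) ** (e21 ** b) = 0.
Proof.
move=> ha hb; swap_asc (asc23 e21 (e21 ** b) a) => ->.
by rewrite M21_M11 // -alt_xxy e21_e21 alt0l.
Qed.

Lemma V21_V21 v z : inV v -> inV z ->
  (e12 ** v) ** (e12 ** z) = - (vform v z ** e12).
Proof.
move=> hv hz; have hf := vformP hv hz.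
swap_asc (asc12 e12 (e12 ** v) z).
rewrite e12_e12_mul alt0l ?sub0r ?opprK (inV_form22 hv hz).
have := M12_M22 e11P hf; rewrite e11_e12 (mul_e11l hf) => -> <-.
by rewrite opprK.
Qed.

Lemma M22_M21 a b : P true true a -> P true true b ->
  copy22 a ** (e21 ** b) = e21 ** (a ** b).
Proof.
move=> ha hb; have := asc23 e21 (e21 ** b) (a ** e12).
rewrite /associator -alt_xxy e21_e21 alt0l alt0l M12_M21 //; pzero.
by rewrite subrr oppr0 => /eqP; rewrite subr_eq0 => /eqP.
Qed.

Lemma M22_V21 a v : P true true a -> inV v ->
  copy22 a ** (e12 ** v) = e12 ** (a ** v).
Proof.
move=> ha hv; have := asc23 e21 (e12 ** v) (a ** e12).
rewrite /associator e21_e12_inV // V21_M12 // M12_V21 // !alt0r !subr0 => ->.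
by rewrite V12_M12 // opprK.
Qed.

Lemma M22_M22 a b : P true true a -> P true true b ->
  copy22 a ** copy22 b = copy22 (a ** b).
Proof.
move=> ha hb; have hc := copy22P ha.
rewrite {2}/copy22.
have <- : copy22 a ** e21 ** (b ** e12) = copy22 a ** (e21 ** (b ** e12)).
  by passoc.
have := M22_M21 ha e11P; rewrite e21_e11 (mul_e11r ha) => ->.
exact: M21_M12.
Qed.
End CoordinateRing.

HB.instance Definition _ (F : fieldType) (A : alt_algebra F) (e : A) i j :=
  GRing.isSubmodClosed.Build F A (peirce e i j) (peirce_submod_closed e i j).

Lemma inV_submod_closed (F : fieldType) (D : M2_alt_algebra F) :
  submod_closed (@inV F D).
Proof.
have [z0 cl] := peirce_submod_closed (e11 : D) true false.
split=> [|k x y /andP[hx /eqP ex] /andP[hy /eqP ey]].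
  by apply/andP; rewrite alt0l; split.
by apply/andP; rewrite altDl altZl ex ey scaler0 addr0; split; first exact: cl.
Qed.

HB.instance Definition _ (F : fieldType) (D : M2_alt_algebra F) :=
  GRing.isSubmodClosed.Build F D (@inV F D) (inV_submod_closed D).

Section Corner.
Variables (F : fieldType) (D : M2_alt_algebra F).

Definition corner := {x : D | peirce e11 true true x}.
HB.instance Definition _ := [isSub of corner for sval].
HB.instance Definition _ := [Choice of corner by <:].
HB.instance Definition _ := [SubChoice_isSubZmodule of corner by <:].
HB.instance Definition _ := [SubZmodule_isSubLmodule of corner by <:].

Definition corner_one : corner := Sub e11 e11P.
Definition corner_mul (a b : corner) : corner :=
  Sub (val a ** val b) (peirce_mul (valP a) (valP b)).

Fact corner_mulA : associative corner_mul.
Proof.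
by move=> a b c; apply: val_inj; rewrite /= cornerA ?(valP a, valP b, valP c).
Qed.
Fact corner_mul1 : left_id corner_one corner_mul.
Proof. by move=> a; apply: val_inj; rewrite /= (mul_e11l (valP a)). Qed.
Fact corner_mulr1 : right_id corner_one corner_mul.
Proof. by move=> a; apply: val_inj; rewrite /= (mul_e11r (valP a)). Qed.
Fact corner_mulDl : left_distributive corner_mul +%R.
Proof. by move=> a b c; apply: val_inj; rewrite /= altDl. Qed.
Fact corner_mulDr : right_distributive corner_mul +%R.
Proof. by move=> a b c; apply: val_inj; rewrite /= altDr. Qed.
Fact corner_one_neq0 : corner_one != 0.
Proof. by rewrite -val_eqE /= e11_neq0. Qed.

HB.instance Definition _ := GRing.Zmodule_isNzRing.Build corner
  corner_mulA corner_mul1 corner_mulr1 corner_mulDl corner_mulDr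
  corner_one_neq0.

Fact corner_scaleAl (k : F) (a b : corner) : k *: (a * b) = k *: a * b.
Proof. by apply: val_inj; rewrite /= altZl. Qed.
HB.instance Definition _ :=
  GRing.Lmodule_isLalgebra.Build F corner corner_scaleAl.
Fact corner_scaleAr (k : F) (a b : corner) : k *: (a * b) = a * (k *: b).
Proof. by apply: val_inj; rewrite /= altZr. Qed.
HB.instance Definition _ :=
  GRing.Lalgebra_isAlgebra.Build F corner corner_scaleAr.

(** In M2(B) + V^2 the summand V^2 is the sum of the Cayley bimodules over the
    matrices; this is its upper half. *)
Definition cayley := {x : D | inV x}.
HB.instance Definition _ := [isSub of cayley for sval].
HB.instance Definition _ := [Choice of cayley by <:].
HB.instance Definition _ := [SubChoice_isSubZmodule of cayley by <:].

Definition cayley_scale (a : corner) (v : cayley) : cayley :=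
  Sub (val a ** val v) (inV_corner (valP a) (valP v)).

Fact cayley_scaleA a b v :
  cayley_scale a (cayley_scale b v) = cayley_scale (a * b) v.
Proof.
apply: val_inj; rewrite /= (assoc_11_11_12 (valP a) (valP b)) //.
exact: inVP (valP v).
Qed.
Fact cayley_scale1 : left_id 1 cayley_scale.
Proof. by move=> v; apply: val_inj; rewrite /= (mul_e11l (inVP (valP v))). Qed.
Fact cayley_scaleDr : right_distributive cayley_scale +%R.
Proof. by move=> a u v; apply: val_inj; rewrite /= altDr. Qed.
Fact cayley_scaleDl v : {morph cayley_scale^~ v : a b / a + b}.
Proof. by move=> a b; apply: val_inj; rewrite /= altDl. Qed.
HB.instance Definition _ := GRing.Zmodule_isLmodule.Build corner cayley
  cayley_scaleA cayley_scale1 cayley_scaleDr cayley_scaleDl.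

Definition cayley_form (u v : cayley) : corner :=
  Sub (vform (val u) (val v)) (vformP (valP u) (valP v)).

End Corner.

(** * Coordinates *)

Section Coordinatization.
Variables (F : fieldType) (D : M2_alt_algebra F).

Let R := corner D.
Let V := cayley D.
Let f : V -> V -> R := @cayley_form F D.
Local Notation P := (peirce (@e11 F D)).

Lemma corner_annihilate : commutators_annihilate V.
Proof.
move=> c v [s ->]; rewrite scaler_suml big1 // => t _.
have comm a b : a *: (b *: v) = b *: (a *: v).
  by apply: val_inj; rewrite /= (corner_inV_comm (valP a) (valP b) (valP v)).
by rewrite -mulr_algl -scalerA scalerBl -!scalerA comm subrr scaler0.
Qed.

Lemma cayley_form_admissible : admissible_form f.
Proof.
have fl v : linear_for *%R (f^~ v).
  move=> a u w; apply: val_inj; rewrite /= vformDl.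
  by have [-> _ _] := corner_form (valP a) (valP u) (valP v).
have fr v : linear_for *%R (f v).
  move=> a u w; apply: val_inj; rewrite /= vformDr.
  by have [_ -> _] := corner_form (valP a) (valP v) (valP u).
split.
- split=> //; split=> v k u w.
  + by have := fl v k%:A u w; rewrite mulr_algl.
  + by have := fr v k%:A u w; rewrite mulr_algl.
- by move=> v; apply: val_inj; rewrite /= /vform (sq12 (inVP (valP v))) alt0r.
- move=> u v b; apply: val_inj => /=.
  by have [_ _ ->] := corner_form (valP b) (valP u) (valP v).
- move=> u v w; apply: val_inj.
  by rewrite /= (vform_jacobi (valP u) (valP v) (valP w)).
Qed.

(** The candidate inverse isomorphism: it is simpler to show that this map is
    multiplicative and bijective than to multiply the coordinates of two
    elements. *)
Definition from_coordinates (X : M2V2 V) : D :=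
  let: (M, (x, y)) := X in
  val (M 0 0) + val (M 0 1) ** e12 + e21 ** val (M 1 0) + copy22 (val (M 1 1))
  + val x + e12 ** val y.

Lemma from_coordinatesE a b c d x y :
  from_coordinates (mx2 a b c d, (x, y)) =
  val a + val b ** e12 + e21 ** val c + copy22 (val d) + val x + e12 ** val y.
Proof. by rewrite /from_coordinates !mxE. Qed.

Lemma copy22D a b : copy22 (a + b) = copy22 a + copy22 b :> D.
Proof. by rewrite /copy22 altDl altDr. Qed.
Lemma copy22Z k a : copy22 (k *: a) = k *: copy22 a :> D.
Proof. by rewrite /copy22 altZl altZr. Qed.
Lemma copy22N a : copy22 (- a) = - copy22 a :> D.
Proof. by rewrite /copy22 altNl altNr. Qed.

Lemma val_corner_lin (k : F) (a b : R) :
  val (k%:A * a + b) = k *: val a + val b.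
Proof. by rewrite mulr_algl. Qed.
Lemma val_cayley_lin (k : F) (u v : V) :
  val ((k%:A : R) *: u + v) = k *: val u + val v.
Proof. by rewrite /= altZl (mul_e11l (inVP (valP u))). Qed.

Lemma from_coordinates_linear : linear from_coordinates.
Proof.
move=> k X Y; have [a [b [c [d [x [y ->]]]]]] := M2V2P X.
have [a' [b' [c' [d' [z [t ->]]]]]] := M2V2P Y.
rewrite M2V2_linE !from_coordinatesE !(val_corner_lin, val_cayley_lin).
rewrite !(altDl, altDr, altZl, altZr, copy22D, copy22Z, scalerDr); zmod.
Qed.

(** The multiplication table on sums of the six kinds of summands: of the 36
    products, 10 vanish for Peirce reasons and the others are known. *)
Lemma coordinate_product (a b c d x y a' b' c' d' z t : D) :
  P true true a -> P true true b -> P true true c -> P true true d ->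
  inV x -> inV y ->
  P true true a' -> P true true b' -> P true true c' -> P true true d' ->
  inV z -> inV t ->
  (a ** a' + b ** c' - vform x t)
  + (a ** b' + b ** d' - vform y t) ** e12
  + e21 ** (c ** a' + d ** c' + vform x z)
  + copy22 (c ** b' + d ** d' + vform y z)
  + (a ** z + c ** t + (d' ** x - c' ** y))
  + e12 ** (b ** z + d ** t + (a' ** y - b' ** x)) =
  (a + b ** e12 + e21 ** c + copy22 d + x + e12 ** y)
  ** (a' + b' ** e12 + e21 ** c' + copy22 d' + z + e12 ** t).
Proof.
move=> ha hb hc hd hx hy ha' hb' hc' hd' hz ht.
have hd22 := copy22P hd; have hd22' := copy22P hd'.
rewrite !(altDl, altDr) !(altNl, altNr) !(copy22D, copy22N).
rewrite -(assoc_11_11_12 ha hb' e12P).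
rewrite (M12_M21 hb hc') (M12_M22 hb hd') (M12_M12 hb hb') (M12_V12 hb hz).
rewrite (M12_V21 hb ht) (M21_M11 hc ha') (M21_M12 hc hb') (M21_M21 hc hc').
rewrite (M21_V12 hc hz) (e21_corner_e12_inV hc ht).
rewrite (M22_M21 hd hc') (M22_M22 hd hd') (M22_V21 hd ht).
rewrite (V12_M21 hc' hx) (inV_copy22 hd' hx) (V12_M12 hb' hx) (mul_inV hx hz).
rewrite (inV_mul_e12_inV hx ht) (e12_inV_corner ha' hy) (V21_M12 hb' hy).
rewrite (e12_inV_e21_corner hc' hy) (inV_form22 hy hz) (V21_V21 hy ht).
pzero; zmod.
Qed.


Lemma from_coordinates_mul X Y :
  from_coordinates (M2V2_mul f X Y) = from_coordinates X ** from_coordinates Y.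
Proof.
have [a [b [c [d [x [y ->]]]]]] := M2V2P X.
have [a' [b' [c' [d' [z [t ->]]]]]] := M2V2P Y.
rewrite M2V2_mulE !from_coordinatesE.
exact: coordinate_product (valP a) (valP b) (valP c) (valP d) (valP x) (valP y)
  (valP a') (valP b') (valP c') (valP d') (valP z) (valP t).
Qed.

Lemma from_coordinates_one : from_coordinates (M2V2_one V) = alt_one D.
Proof.
rewrite /M2V2_one /from_coordinates !mxE /= alt0l !alt0r !addr0 -e11_e22.
by rewrite /copy22 e11_e12 e21_e12.
Qed.

Lemma peirce_direct s t p q : P true true s -> P true false t ->
  P false true p -> P false false q -> s + t + p + q = 0 ->
  [/\ s = 0, t = 0, p = 0 & q = 0].
Proof.
move=> hs ht hp hq h0.
have s0 : s = 0.
  have := congr1 (fun x => e11 ** x ** e11) h0.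
  rewrite !(altDl, altDr) (mul_e11l hs) (mul_e11l ht) (mul_e11r hs); pzero.
  by rewrite !addr0.
have t0 : t = 0.
  have := congr1 (alt_mul e11) h0.
  by rewrite !altDr s0 (mul_e11l ht); pzero; rewrite add0r !addr0.
have p0 : p = 0.
  have := congr1 (fun x => x ** e11) h0.
  by rewrite /= !altDl s0 t0 (mul_e11r hp); pzero; rewrite !add0r addr0.
by split=> //; move: h0; rewrite s0 t0 p0 !add0r.
Qed.

(** The Peirce components separate all but b e12 from x and e21 c from e12 y;
    multiplication by e21 on the right, resp. e12 on the left, kills x,
    resp. e12 y. *)
Lemma coordinates_eq0 (a b c d x y : D) :
  P true true a -> P true true b -> P true true c -> P true true d ->
  inV x -> inV y ->
  a + b ** e12 + e21 ** c + copy22 d + x + e12 ** y = 0 ->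
  [/\ a = 0, b = 0, c = 0 & d = 0] /\ (x = 0 /\ y = 0).
Proof.
move=> ha hb hc hd hx hy h.
have h12 : P true false (b ** e12 + x) by ptyped.
have h21 : P false true (e21 ** c + e12 ** y) by ptyped.
have [|a0 bx0 cy0 d0] := peirce_direct ha h12 h21 (copy22P hd).
  by rewrite -[RHS]h; zmod.
have b0 : b = 0.
  rewrite -[LHS](corner_e12_e21 hb) -[RHS](alt0l e21) -bx0 altDl (inV_e21 hx).
  by rewrite addr0.
have c0 : c = 0.
  have := M12_M21 e11P hc; rewrite e11_e12 (mul_e11l hc) => <-.
  by rewrite -[RHS](alt0r e12) -cy0 altDr e12_e12_mul addr0.
split; split=> //.
- have := M12_M22 e11P hd; rewrite d0 alt0r (mul_e11l hd) => du0.
  by rewrite -(corner_e12_e21 hd) -du0 alt0l.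
- by move: bx0; rewrite b0 alt0l add0r.
- rewrite -(e21_e12_inV hy); move: cy0; rewrite c0 alt0r add0r => ->.
  by rewrite alt0r.
Qed.

Lemma from_coordinates_inj : injective from_coordinates.
Proof.
suff ker0 X : from_coordinates X = 0 -> X = 0.
  move=> X Y eqXY; apply/eqP; rewrite -subr_eq0; apply/eqP/ker0.
  by rewrite addrC -scaleN1r from_coordinates_linear eqXY scaleN1r addNr.
have [a [b [c [d [x [y ->]]]]]] := M2V2P X; rewrite from_coordinatesE => h.
have [[a0 b0 c0 d0] [x0 y0]] := coordinates_eq0 (valP a) (valP b) (valP c)
  (valP d) (valP x) (valP y) h.
have -> : a = 0 by exact: val_inj.
have -> : b = 0 by exact: val_inj.
have -> : c = 0 by exact: val_inj.
have -> : d = 0 by exact: val_inj.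
have -> : x = 0 by exact: val_inj.
have -> : y = 0 by exact: val_inj.
by congr (_, _); apply/matrixP => i j; rewrite !mxE !if_same.
Qed.

Lemma idem_l (x : D) : e11 ** (e11 ** x) = e11 ** x.
Proof. by rewrite -alt_xxy e11_e11. Qed.
Lemma idem_r (x : D) : x ** e11 ** e11 = x ** e11.
Proof. by rewrite alt_yxx e11_e11. Qed.

Lemma peirce_decomposition (x : D) : exists s t p q,
  [/\ P true true s, P true false t, P false true p, P false false q
    & x = s + t + p + q].
Proof.
exists (e11 ** x ** e11), (e11 ** x - e11 ** x ** e11),
  (x ** e11 - e11 ** x ** e11), (x - e11 ** x - x ** e11 + e11 ** x ** e11).
have idem_m : e11 ** (e11 ** x ** e11) = e11 ** x ** e11.
  by rewrite -alt_flex idem_l.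
split; [apply/peirceP..|by zmod].
all: split; rewrite ?(altDl, altDr, altNl, altNr) ?idem_m ?idem_l ?idem_r.
all: rewrite ?mulr1n ?mulr0n -?alt_flex ?idem_l ?idem_r; try zmod.
Qed.

Lemma from_coordinates_surj x : exists X, x = from_coordinates X.
Proof.
have [s [t [p [q [hs ht hp hq ->]]]]] := peirce_decomposition x.
(* y |-> (y e21) e12 projects A12 onto A11 e12 along V. *)
have split12 y : P true false y -> inV (y - y ** e21 ** e12).
  move=> hy; apply/andP; split; first by ptyped.
  by rewrite altDl altNl corner_e12_e21 ?subrr //; ptyped.
have hb : P true true (t ** e21) by ptyped.
have hc : P true true (e12 ** p) by ptyped.
have hd : P true true (e12 ** q ** e21) by ptyped.
have hx := split12 _ ht.
have hy : inV (e21 ** p).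
  apply/andP; split; first by ptyped.
  by rewrite alt_flex (skew21 e21P hp) altNr -alt_xxy e21_e21 alt0l oppr0.
exists (mx2 (Sub s hs : R) (Sub _ hb : R) (Sub _ hc : R) (Sub _ hd : R),
        (Sub _ hx : V, Sub _ hy : V)); rewrite from_coordinatesE /=.
(* As e11 p = 0, the alternation of e12, e21, p splits p along e12 V. *)
have eqp : e21 ** (e12 ** p) + e12 ** (e21 ** p) = p.
  have := asc12 e12 e21 p; rewrite /associator e12_e21 e21_e12; pzero.
  by rewrite (mul_e22l hp) sub0r opprK => <-; rewrite addrC subrK.
(* The V component of e12 q is killed by e21 and does not contribute. *)
have eqq : copy22 (e12 ** q ** e21) = q.
  have huq : P true false (e12 ** q) by ptyped.
  have := e21_inV (split12 _ huq); rewrite altDr altNr => /eqP.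
  rewrite subr_eq0 /copy22 => /eqP <-.
  have <- : e21 ** e12 ** q = e21 ** (e12 ** q) by passoc.
  by rewrite e21_e12 (mul_e22l hq).
rewrite eqq -{1}eqp; zmod.
Qed.

Lemma coordinatization : exists h : D -> M2V2 V,
  unital_algebra_iso (@alt_mul _ D) (alt_one D) (M2V2_mul f) (M2V2_one V) h.
Proof.
have surj x : exists X, from_coordinates X == x.
  by have [X ->] := from_coordinates_surj x; exists X.
pose h x := xchoose (surj x).
have hK : cancel h from_coordinates.
  by move=> x; apply/eqP; exact: (xchooseP (surj x)).
exists h; split.
- move=> k x y; apply: from_coordinates_inj.
  by rewrite from_coordinates_linear !hK.
- by move=> x y; apply: from_coordinates_inj; rewrite from_coordinates_mul !hK.
- by apply: from_coordinates_inj; rewrite from_coordinates_one hK.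
- exists from_coordinates => // X; apply: from_coordinates_inj; exact: hK.
Qed.
End Coordinatization.

Theorem theorem5p1 (F : fieldType) :
  (forall (B : algType F) (V : lmodType B) (f : V -> V -> B),
     commutators_annihilate V -> admissible_form f ->
     unital_alternative_algebra (M2V2_mul f) (M2V2_one V) /\
     M2_embedding (M2V2_mul f) (M2V2_one V) (M2V2_incl V))
  /\
  (forall (A : lmodType F) (mul : A -> A -> A) (one : A),
     unital_alternative_algebra mul one ->
     (exists phi : 'M[F]_2 -> A, M2_embedding mul one phi) ->
     exists (B : algType F) (V : lmodType B) (f : V -> V -> B),
       [/\ commutators_annihilate V, admissible_form f &
           exists h : A -> M2V2 V,
             unital_algebra_iso mul one (M2V2_mul f) (M2V2_one V) h]).
Proof.
split=> [B V f|A mul one altA [phi phiP]]; first exact: M2V2_construction.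
pose D := M2AltAlgebra (M2_base := AltAlgebra altA) phiP.
exists (corner D), (cayley D), (@cayley_form F D); split.
- exact: corner_annihilate.
- exact: cayley_form_admissible.
- exact: (coordinatization D).
Qed.
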